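(* Let $n\in\mathbb{N}$ and let $p_1<p_2<p_3<p_4$ be primes. (i) If $n=p_1^{\alpha_1}p_2^{\alpha_2}$ with $\alpha_1,\alpha_2\in\mathbb{N}$, then $\overline{p_2^{\alpha_2}}$ has minimum degree among all vertices of $\mathcal{G}(\mathbb{Z}_n)$, and $\delta(\mathcal{G}(\mathbb{Z}_n))=(p_2^{\alpha_2}-1)\phi(p_1^{\alpha_1})+p_1^{\alpha_1}-1$. (ii) If $n=p_1p_2p_3$, then $\overline{p_3}$ has minimum degree among all vertices of $\mathcal{G}(\mathbb{Z}_n)$, and $\delta(\mathcal{G}(\mathbb{Z}_n))=\phi(n)+p_1p_2-1$. (iii) Let $n=p_1p_2p_3p_4$. If $n$ is odd or $p_4\ge p_3+\frac{2(p_3-1)}{p_2-1}$, then $\overline{p_4}$ has minimum degree among all vertices of $\mathcal{G}(\mathbb{Z}_n)$ and $\delta(\mathcal{G}(\mathbb{Z}_n))=\phi(n)+p_1p_2p_3-1$. Otherwise, $\overline{p_3p_4}$ has minimum degree among all vertices of $\mathcal{G}(\mathbb{Z}_n)$ and $\delta(\mathcal{G}(\mathbb{Z}_n))=(p_2-1)(p_3p_4+1)+1$.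
   Context: $\mathbb{Z}_n$ is the additive group of integers modulo $n$; $\phi$ is Euler's phi function. The power graph $\mathcal{G}(G)$ of a group $G$ has vertex set $G$, distinct $u,v$ adjacent iff one is a positive integer power (multiple) of the other. $\delta$ denotes minimum degree. *)

(* Defs.v *)
From mathcomp Require Import all_boot all_order all_algebra all_fingroup.
From mathcomp Require Import boolp.

Set Implicit Arguments.
Unset Strict Implicit.
Unset Printing Implicit Defensive.

Import GroupScope.

Section SimpleGraph.
Variables (T : finType) (e : rel T).

Definition degree (x : T) : nat := #|[set y | e x y]|.

Definition is_min_degree_vertex (x : T) : Prop :=
  forall y : T, (degree x <= degree y)%N.

(* Loopless graphs have all degrees below #|T|, so the default value #|T|
   never contributes when T is nonempty. *)
Definition min_degree : nat := \big[minn/#|T|]_(x : T) degree x.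

End SimpleGraph.

Section PowerGraph.
Variable gT : finGroupType.

Definition is_pos_power (u v : gT) : Prop :=
  exists k : nat, (0 < k)%N /\ u = v ^+ k.

Definition power_graph : rel gT :=
  fun u v => (u != v) && `[< is_pos_power u v \/ is_pos_power v u >].

End PowerGraph.

(* The finGroupType structure of 'Z_n is the additive one: in group_scope,
   v ^+ k : 'Z_n is the multiple v *+ k. *)
Definition power_graph_Zn (n : nat) : rel 'Z_n := @power_graph 'Z_n.

(* Main.v *)
(* In the cyclic group Z_n, x is adjacent to y iff the order of one divides the
   order of the other, so the degree of a vertex depends only on its order m:
   deg + 1 + phi(m) = m + S(n, m), where S(n, m) is the sum of phi(d) over the
   d with m | d | n.  S is multiplicative over coprime factorizations of n,
   with S(n, 1) = n and S(p^a, p^(i+1)) = p^a - p^i, so everything reduces to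
   inequalities between explicit expressions.  When the gaps between consecutive
   primes are taken as natural number variables, each difference becomes a
   polynomial with nonnegative coefficients; the only exception is the comparison
   of the orders p1 p2 and p1 p2 p3 for p1 = 2, which amounts to the numerical
   condition of part (iii). *)
From Stdlib Require Import ZArith.
Require Import Defs.
From mathcomp Require Import all_boot all_order all_algebra all_fingroup.
From mathcomp Require Import cyclic boolp zify.

Set Implicit Arguments.
Unset Strict Implicit.
Unset Printing Implicit Defensive.

Import Order.TTheory GRing.Theory Num.Theory.

(** * Totient sums over the divisors of [n] that are multiples of [m] *)

Definition mult_totient_sum (n m : nat) : nat :=
  \sum_(d <- divisors n | m %| d) totient d.

Lemma sum_totient_divisors n : 0 < n -> \sum_(d <- divisors n) totient d = n.
Proof.
move=> n_gt0; rewrite -[RHS]sum_totient_dvd -(big_mkord (dvdn^~ n)) -[RHS]big_filter.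
apply: perm_big; apply: uniq_perm => [||d]; rewrite ?divisors_uniq //.
  by rewrite filter_uniq ?iota_uniq.
rewrite mem_filter mem_index_iota -dvdn_divisors //.
by case: (boolP (d %| n)) => //= /dvdn_leq; rewrite ltnS => ->.
Qed.

Lemma mult_totient_sum1 n : 0 < n -> mult_totient_sum n 1 = n.
Proof.
move=> n_gt0; rewrite -[RHS]sum_totient_divisors //.
by apply: eq_bigl => d; rewrite dvd1n.
Qed.

(** The divisors of [p ^ a] that are not multiples of [p ^ i.+1] are exactly the divisors of
    [p ^ i], and their totients sum to [p ^ i]. *)
Lemma mult_totient_sum_pfactor p i a : prime p -> i < a ->
  mult_totient_sum (p ^ a) (p ^ i.+1) + p ^ i = p ^ a.
Proof.
move=> p_pr lt_ia; have pX_gt0 k : 0 < p ^ k by rewrite expn_gt0 prime_gt0.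
rewrite -[RHS](@sum_totient_divisors (p ^ a)) //.
rewrite [RHS](bigID (dvdn (p ^ i.+1))) /=; congr (_ + _).
rewrite -[LHS]sum_totient_divisors // -[RHS]big_filter.
apply: perm_big; apply: uniq_perm => [||d]; rewrite ?divisors_uniq //.
  by rewrite filter_uniq ?divisors_uniq.
rewrite mem_filter -!dvdn_divisors //.
apply/idP/andP => [/(dvdn_pfactor _ _ p_pr)[j le_ji ->] | [ndvd]].
  by rewrite !dvdn_Pexp2l ?prime_gt1 // -ltnNge ltnS le_ji (leq_trans le_ji) // ltnW.
move=> /(dvdn_pfactor _ _ p_pr)[j le_ja d_def]; move: ndvd.
by rewrite d_def !dvdn_Pexp2l ?prime_gt1 // -ltnNge ltnS.
Qed.

Lemma mult_totient_sum_prime p : prime p -> mult_totient_sum p p = p.-1.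
Proof.
by move=> p_pr; have := mult_totient_sum_pfactor p_pr (isT : 0 < 1); rewrite !expn1; lia.
Qed.

Lemma dvdn_mul_coprime n1 n2 m1 m2 d1 d2 : coprime n1 n2 ->
  m1 %| n1 -> m2 %| n2 -> d1 %| n1 -> d2 %| n2 ->
  (m1 * m2 %| d1 * d2) = (m1 %| d1) && (m2 %| d2).
Proof.
move=> co m1n m2n d1n d2n; rewrite Gauss_dvd ?(coprime_dvdl m1n) ?(coprime_dvdr m2n) //.
rewrite Gauss_dvdl ?Gauss_dvdr //.
  by rewrite (coprime_dvdl m2n) // (coprime_dvdr d1n) // coprime_sym.
by rewrite (coprime_dvdl m1n) // (coprime_dvdr d2n).
Qed.

(** With [d1] the gcd of [d] and [n1], the quotient [d %/ d1] is coprime to [n1 %/ d1], hence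
    divides [n2]. *)
Lemma dvdn_mul_split d n1 n2 : 0 < n1 -> d %| n1 * n2 ->
  exists d1 d2, [/\ d = d1 * d2, d1 %| n1 & d2 %| n2].
Proof.
move=> n1_gt0 d_dvd; set g := gcdn d n1.
have g_gt0 : 0 < g by rewrite gcdn_gt0 n1_gt0 orbT.
exists g, (d %/ g); rewrite mulnC divnK ?dvdn_gcdl // dvdn_gcdr; split=> //.
have co : coprime (d %/ g) (n1 %/ g).
  by rewrite /coprime -(eqn_pmul2l g_gt0) muln_gcdr ![g * (_ %/ g)]mulnC !divnK ?dvdn_gcdl ?dvdn_gcdr ?muln1.
rewrite -(Gauss_dvdr _ co) -(dvdn_pmul2l g_gt0) mulnA ![g * (_ %/ g)]mulnC.
by rewrite !divnK ?dvdn_gcdl ?dvdn_gcdr.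
Qed.

Lemma divisors_coprimeM n1 n2 : 0 < n1 -> 0 < n2 -> coprime n1 n2 ->
  perm_eq (divisors (n1 * n2)) [seq d1 * d2 | d1 <- divisors n1, d2 <- divisors n2].
Proof.
move=> n1_gt0 n2_gt0 co.
apply: uniq_perm; rewrite ?divisors_uniq //.
  apply: allpairs_uniq; rewrite ?divisors_uniq // => ab cd.
  move=> /allpairsP[[a b] /= [ha hb ->]] /allpairsP[[c d] /= [hc hd ->]] /= e.
  move: ha hb hc hd; rewrite -!dvdn_divisors // => ha hb hc hd.
  (* Equal products divide each other, so their components do too and are equal. *)
  move: (dvdnn (a * b)) (dvdnn (c * d)); rewrite {2}e -{3}e.
  rewrite !(dvdn_mul_coprime co) // => /andP[ac bd] /andP[ca db].
  by congr pair; apply/eqP; rewrite eqn_dvd ?ac ?ca ?bd ?db.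
move=> d; rewrite -dvdn_divisors ?muln_gt0 ?n1_gt0 //.
apply/idP/allpairsP => [d_dvd | [[a b] /= [ha hb ->]]]; last first.
  by rewrite dvdn_mul // dvdn_divisors.
have [d1 [d2 [-> d1n d2n]]] := dvdn_mul_split n1_gt0 d_dvd.
by exists (d1, d2); rewrite -!dvdn_divisors.
Qed.

Lemma mult_totient_sumM n1 n2 m1 m2 : 0 < n1 -> 0 < n2 -> coprime n1 n2 ->
  m1 %| n1 -> m2 %| n2 ->
  mult_totient_sum (n1 * n2) (m1 * m2) = mult_totient_sum n1 m1 * mult_totient_sum n2 m2.
Proof.
move=> n1_gt0 n2_gt0 co m1n m2n.
rewrite /mult_totient_sum (perm_big _ (divisors_coprimeM n1_gt0 n2_gt0 co)) /=.
rewrite big_mkcond big_allpairs_dep [X in _ = X * _]big_mkcond big_distrl big_seq [RHS]big_seq /=.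
apply: eq_bigr => d1; rewrite -dvdn_divisors // => d1n.
rewrite [X in _ = _ * X]big_mkcond big_distrr big_seq [RHS]big_seq /=.
apply: eq_bigr => d2; rewrite -dvdn_divisors // => d2n.
rewrite (dvdn_mul_coprime co) // totient_coprime.
  by case: (m1 %| d1); case: (m2 %| d2); rewrite ?muln0.
by rewrite (coprime_dvdl d1n) // (coprime_dvdr d2n).
Qed.

(** * Degrees in the power graph of a cyclic group *)

(** Elements are sorted by order: a cyclic group has [totient d] elements of each order [d] dividing
    its own. *)
Lemma card_dvdn_order (gT : finGroupType) (m : nat) : cyclic [set: gT] ->
  #|[set y : gT | m %| #[y]%g]| = mult_totient_sum #|gT| m.
Proof.
move=> /cyclicP[g gE]; have g_ord : #[g]%g = #|gT| by rewrite orderE -gE cardsT.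
have gT_gt0 : 0 < #|gT| by rewrite -g_ord order_gt0.
have cyc : cyclic [set: gT] by apply/cyclicP; exists g.
have totE d : d \in divisors #|gT| -> totient d = \sum_(y : gT | #[y]%g == d) 1.
  rewrite -dvdn_divisors // => d_dvd.
  have [x x_ord] : exists x : gT, #[x]%g = d.
    have [k def_n] := dvdnP d_dvd.
    exists (g ^+ k)%g; rewrite orderXdiv g_ord def_n ?dvdn_mulr // mulKn //.
    by move: gT_gt0; rewrite def_n muln_gt0 => /andP[].
  (* The elements of order [d] are the generators of the only subgroup of that order. *)
  rewrite -x_ord totient_gen sum1dep_card; apply: eq_card => y; rewrite !inE.
  by rewrite /generator (eq_subG_cyclic cyc) ?subsetT // eq_sym.
rewrite -sum1dep_card /mult_totient_sum [RHS]big_seq_cond.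
under [RHS]eq_bigr => d /andP[d_in _] do rewrite totE //.
rewrite -[RHS]big_seq_cond [RHS](exchange_big_dep (fun y : gT => m %| #[y]%g)) /=; last first.
  by move=> d y m_d /eqP->.
apply: eq_bigr => y m_y.
have y_dvd : #[y]%g \in divisors #|gT|.
  by rewrite -dvdn_divisors // -cardsT order_dvdG ?inE.
rewrite (big_rem _ y_dvd) /= m_y eqxx /= big_seq_cond big1 ?addn0 // => d.
rewrite rem_filter ?divisors_uniq // mem_filter /=.
by case/andP=> /andP[/negP d_ne _] /andP[_ /eqP d_eq]; case: d_ne; rewrite d_eq.
Qed.

Lemma cyclic_order_dvdn (gT : finGroupType) (x y : gT) : cyclic [set: gT] ->
  (#[x]%g %| #[y]%g) = (x \in <[y]>%g).
Proof. by move=> cyc; rewrite !orderE (cardSg_cyclic cyc) ?subsetT // cycle_subG. Qed.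

Lemma is_pos_powerP (gT : finGroupType) (x y : gT) :
  is_pos_power x y <-> x \in <[y]>%g.
Proof.
split=> [[k [_ ->]] | /cycleP[k ->]]; first exact: mem_cycle.
(* The exponent [k] may be 0; adding the order of [y] makes it positive and keeps the power. *)
exists (k + #[y]%g); split; first by rewrite addn_gt0 order_gt0 orbT.
by rewrite expgD expg_order mulg1.
Qed.

(** Inclusion-exclusion for the subgroup generated by [x] and the set of elements whose order is a
    multiple of that of [x]: the union is the closed neighbourhood of [x], the intersection consists
    of the generators of the subgroup. The 1 counts [x] itself. *)
Lemma degree_power_graph_cyclic (gT : finGroupType) (x : gT) : cyclic [set: gT] ->
  degree (@power_graph gT) x + totient #[x]%g + 1
    = #[x]%g + mult_totient_sum #|gT| #[x]%g.
Proof.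
move=> cyc; rewrite -card_dvdn_order // {3}/order -cardsUI.
set A := (_ :|: _); have -> : A = x |: [set y | @power_graph gT x y].
  apply/setP=> y; rewrite !inE /power_graph cyclic_order_dvdn //.
  case: eqVneq => [->|_] /=; first by rewrite cycle_id.
  apply/idP/asboolP.
    by case/orP=> /is_pos_powerP; [right | left].
  by case=> /is_pos_powerP ->; rewrite ?orbT.
have -> : totient #[x]%g = #|<[x]>%g :&: [set y | #[x]%g %| #[y]%g]|.
  rewrite totient_gen; apply: eq_card => y; rewrite !inE cyclic_order_dvdn //.
  by rewrite /generator eqEsubset !cycle_subG andbC.
by rewrite cardsU1 inE /power_graph eqxx /= add1n addn1 addSn.
Qed.

Lemma is_min_degree_vertex_min_degree (T : finType) (e : rel T) (x : T) :
  is_min_degree_vertex e x -> min_degree e = degree e x.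
Proof.
move=> x_min; apply/eqP; rewrite eqn_leq; apply/andP; split.
  rewrite /min_degree; have := mem_index_enum x.
  elim: (index_enum T) => //= y s IHs; rewrite inE big_cons => /orP[/eqP<-|/IHs].
    exact: geq_minl.
  exact: leq_trans (geq_minr _ _).
rewrite /min_degree; elim/big_ind: _ => [|a b a_ge b_ge|y _]; last exact: x_min.
  (* The default value [#|T|] of the iterated minimum bounds every degree. *)
  exact: max_card.
by rewrite leq_min a_ge.
Qed.

Lemma Zn_cyclic n : cyclic [set: 'Z_n].
Proof. by apply/cyclicP; exists Zp1; rewrite Zp_cycle. Qed.

Lemma order_Zn_nat n k : 1 < n -> k %| n -> #[k%:R%R : 'Z_n]%g = n %/ k.
Proof.
move=> n_gt1 k_dvd; rewrite (_ : k%:R%R = (Zp1 : 'Z_n) ^+ k)%g.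
  by rewrite orderXdiv order_Zp1 Zp_cast.
by rewrite Zp_expg Zp_nat /= modn_small ?mul1n.
Qed.

(** * Polynomial inequalities between degrees *)

(* Proves an inequality whose difference has only nonnegative coefficients.
   The normal form found by ring_simplify is reproved by ring, because the proof
   term of ring_simplify itself is intractable for the kernel. *)
Ltac leq_poly :=
  zify; apply (proj2 (Z.leb_le _ _)); apply (proj1 (Z.le_0_sub _ _));
  match goal with |- Z.le Z0 ?x =>
    let nf := constr:(ltac:(eexists; match goal with |- ?l = _ => ring_simplify l end;
                            reflexivity) : exists y, x = y) in
    match nf with ex_intro _ ?y _ => replace x with y by ring end
  end;
  repeat (apply Z.add_nonneg_nonneg || apply Z.mul_nonneg_nonneg || apply Z.pow_nonneg);
  solve [assumption | by []].

(* The possible values of m, S(p u, m) and phi(m) for a divisor m of p u, where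
   u is a power of p: either m = 1, or m = p (x + 1) with x + 1 dividing u. *)
Definition pfactor_case p u (m S t : nat) : Prop :=
  [\/ [/\ m = 1, S = p * u & t = 1] |
      exists x e, [/\ u = x.+1 * e.+1, m = p * x.+1, S = x.+1 * (p * e.+1).-1 & t = p.-1 * x.+1]].

(** Compares the degree at order [p * u] with that at order [m1 * m2]; each subtracted totient is
    moved to the other side to avoid truncated subtraction. *)
Lemma pfactor_bound p q u v m1 S1 t1 m2 S2 t2 : 1 < p -> p < q -> 0 < u -> 0 < v ->
  pfactor_case p u m1 S1 t1 -> pfactor_case q v m2 S2 t2 ->
  p * u + (p.-1 * u) * (q * v) + t1 * t2 <= m1 * m2 + S1 * S2 + p.-1 * u.
Proof.
move=> p_gt1 pq u_gt0 v_gt0.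
have pred_mul c d : (c.+2 * d.+1).-1 = c.+1 + c.+2 * d by lia.
have [a aE] : exists a, p = a.+2 by exists (p - 2); lia.
have [b bE] : exists b, q = (a + b).+3 by exists (q - p.+1); lia.
have [u' uE] : exists u', u = u'.+1 by exists u.-1; lia.
have [v' vE] : exists v', v = v'.+1 by exists v.-1; lia.
case=> [[-> -> ->] | [x [e [u_def -> -> ->]]]]; case=> [[-> -> ->] | [y [f [v_def -> -> ->]]]];
  rewrite ?u_def ?v_def ?uE ?vE bE aE ?pred_mul ?succnK;
  by clear; leq_poly.
Qed.

(** The order [p * q] against any divisor, given by its exponents; for a prime [p], the totient sum
    of [p] at [p ^ b1] is [p - b1]. *)
Lemma squarefree3_bound p q r (b1 b2 b3 : bool) : 1 < p -> p < q -> q < r ->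
  p * q + p.-1 * q.-1 * r + p.-1 ^ b1 * q.-1 ^ b2 * r.-1 ^ b3 <=
  p ^ b1 * q ^ b2 * r ^ b3 + (p - b1) * (q - b2) * (r - b3) + p.-1 * q.-1.
Proof.
move=> p_gt1 pq qr.
have [a aE] : exists a, p = a.+2 by exists (p - 2); lia.
have [b bE] : exists b, q = (a + b).+3 by exists (q - p.+1); lia.
have [c cE] : exists c, r = (a + b + c).+4 by exists (r - q.+1); lia.
subst; clear.
by case: b1 b2 b3 => [] [] []; rewrite ?expn0 ?expn1 ?subn0 ?subn1 /=; leq_poly.
Qed.

(** The candidate order is [p * q * r]. Odd primes are at least 3 and differ by at least 2, hence
    the shifts 3, 5, 7, 9 in the substitutions. *)
Lemma squarefree4_odd_bound p q r s (b1 b2 b3 b4 : bool) :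
  2 < p -> p.+1 < q -> q.+1 < r -> r.+1 < s ->
  p * q * r + p.-1 * q.-1 * r.-1 * s + p.-1 ^ b1 * q.-1 ^ b2 * r.-1 ^ b3 * s.-1 ^ b4 <=
  p ^ b1 * q ^ b2 * r ^ b3 * s ^ b4 + (p - b1) * (q - b2) * (r - b3) * (s - b4)
  + p.-1 * q.-1 * r.-1.
Proof.
move=> p_gt2 pq qr rs.
have [a aE] : exists a, p = a.+3 by exists (p - 3); lia.
have [b bE] : exists b, q = (a + b).+4.+1 by exists (q - p.+2); lia.
have [c cE] : exists c, r = (a + b + c).+4.+3 by exists (r - q.+2); lia.
have [d dE] : exists d, s = (a + b + c + d).+4.+4.+1 by exists (s - r.+2); lia.
subst; clear.
by case: b1 b2 b3 b4 => [] [] [] []; rewrite ?expn0 ?expn1 ?subn0 ?subn1 /=; leq_poly.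
Qed.

(** The case [p = 2] with candidate order [2 * q * r]; the factors 1 stand for [p.-1]. *)
Lemma squarefree4_even_far_bound q r s (b1 b2 b3 b4 : bool) :
  2 < q -> q < r -> r < s -> 2 * r.-1 <= (s - r) * q.-1 ->
  2 * q * r + 1 * q.-1 * r.-1 * s + 1 ^ b1 * q.-1 ^ b2 * r.-1 ^ b3 * s.-1 ^ b4 <=
  2 ^ b1 * q ^ b2 * r ^ b3 * s ^ b4 + (2 - b1) * (q - b2) * (r - b3) * (s - b4)
  + 1 * q.-1 * r.-1.
Proof.
move=> q_gt2 qr rs.
have [b bE] : exists b, q = b.+3 by exists (q - 3); lia.
have [c cE] : exists c, r = (b + c).+4 by exists (r - q.+1); lia.
have [d dE] : exists d, s = (b + c + d).+4.+1 by exists (s - r.+1); lia.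
subst; clear; rewrite (_ : (b + c + d).+4.+1 - (b + c).+4 = d.+1) => [bound|]; last by lia.
case: b1 b2 b3 b4 => [] [] [] []; rewrite ?expn0 ?expn1 ?subn0 ?subn1 /=.
(* Order 2 q, where the inequality is the hypothesis bound. *)
4: by move: bound => /=; lia.
all: by clear; leq_poly.
Qed.

(** Below the threshold the candidate order becomes [2 * q]. *)
Lemma squarefree4_even_close_bound q r s (b1 b2 b3 b4 : bool) :
  2 < q -> q < r -> r < s -> (s - r) * q.-1 < 2 * r.-1 ->
  2 * q + 1 * q.-1 * r * s + 1 ^ b1 * q.-1 ^ b2 * r.-1 ^ b3 * s.-1 ^ b4 <=
  2 ^ b1 * q ^ b2 * r ^ b3 * s ^ b4 + (2 - b1) * (q - b2) * (r - b3) * (s - b4)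
  + 1 * q.-1.
Proof.
move=> q_gt2 qr rs.
have [b bE] : exists b, q = b.+3 by exists (q - 3); lia.
have [c cE] : exists c, r = (b + c).+4 by exists (r - q.+1); lia.
have [d dE] : exists d, s = (b + c + d).+4.+1 by exists (s - r.+1); lia.
subst; clear; rewrite (_ : (b + c + d).+4.+1 - (b + c).+4 = d.+1) => [bound|]; last by lia.
case: b1 b2 b3 b4 => [] [] [] []; rewrite ?expn0 ?expn1 ?subn0 ?subn1 /=.
(* Order 2 q r, where the inequality is the hypothesis bound. *)
2: by move: bound => /=; lia.
all: by clear; leq_poly.
Qed.

(** * Totient data of divisors, prime by prime *)

(** The values [m], [S] and [t] determine a degree and all multiply over coprime factors, so they
    are carried together. *)
Definition totient_data (n m S t : nat) : Prop :=
  [/\ m %| n, mult_totient_sum n m = S & totient m = t].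

Lemma totient_dataM n1 n2 m1 S1 t1 m2 S2 t2 : 0 < n1 -> 0 < n2 -> coprime n1 n2 ->
  totient_data n1 m1 S1 t1 -> totient_data n2 m2 S2 t2 ->
  totient_data (n1 * n2) (m1 * m2) (S1 * S2) (t1 * t2).
Proof.
move=> n1_gt0 n2_gt0 co [m1n <- <-] [m2n <- <-]; split; first exact: dvdn_mul.
  exact: mult_totient_sumM.
by rewrite totient_coprime // (coprime_dvdl m1n) // (coprime_dvdr m2n).
Qed.

(* A divisor of a prime is encoded by a boolean, read as the exponent 0 or 1. *)
Lemma totient_data_prime p (b : bool) : prime p ->
  totient_data p (p ^ b) (p - b) (p.-1 ^ b).
Proof.
move=> p_pr; case: b; rewrite ?expn0 ?expn1 ?subn0 ?subn1.
  by split; rewrite ?mult_totient_sum_prime ?totient_prime.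
by split; rewrite ?mult_totient_sum1 ?dvd1n ?prime_gt0.
Qed.

Lemma dvdn_primeP p m : prime p -> m %| p -> exists b : bool, m = p ^ b.
Proof.
by move=> p_pr; rewrite -{1}(expn1 p) => /(dvdn_pfactor _ _ p_pr)[[|[|//]] _ ->];
   [exists false | exists true].
Qed.

Lemma totient_data_pfactor p a : prime p ->
  totient_data (p ^ a.+1) (p ^ a.+1) (p.-1 * p ^ a) (p.-1 * p ^ a).
Proof.
move=> p_pr; split; rewrite ?totient_pfactor //.
by have := mult_totient_sum_pfactor p_pr (ltnSn a); rewrite expnS; have := prime_gt0 p_pr; case: p {p_pr} => //= p _; lia.
Qed.

Lemma dvdn_pfactor_data p a m : prime p -> m %| p ^ a.+1 ->
  exists S t, pfactor_case p (p ^ a) m S t /\ totient_data (p ^ a.+1) m S t.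
Proof.
move=> p_pr /(dvdn_pfactor _ _ p_pr)[[|i] le_ia ->].
  exists (p ^ a.+1), 1; split; first by left; rewrite -expnS.
  by split; rewrite ?mult_totient_sum1 ?dvd1n ?expn_gt0 ?prime_gt0.
have pX j : p ^ j = (p ^ j).-1.+1 by rewrite prednK // expn_gt0 prime_gt0.
exists (p ^ i * (p * p ^ (a - i)).-1), (p.-1 * p ^ i); split.
  (* In the encoding, [x.+1] is [p ^ i] and [e.+1] is [p ^ (a - i)]. *)
  right; exists (p ^ i).-1, (p ^ (a - i)).-1; rewrite -!pX -expnS; split=> //.
  by rewrite -expnD subnKC.
split; rewrite ?totient_pfactor ?dvdn_exp2l //.
have := mult_totient_sum_pfactor p_pr le_ia.
rewrite -{2}(subnKC le_ia) addSn -addnS -expnS expnD.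
by rewrite (pX (a - i).+1) mulnS /=; lia.
Qed.

(** The residue [k] has order [m] and degree [m + S - t - 1], and every vertex has order dividing
    [n]; hence minimality is an inequality over the divisors of [n]. *)
Lemma min_degree_power_graph_Zn n k m S t : 1 < n -> n = k * m -> totient_data n m S t ->
  (forall m', m' %| n ->
    exists S' t', totient_data n m' S' t' /\ m + S + t' <= m' + S' + t) ->
  is_min_degree_vertex (@power_graph_Zn n) (k%:R%R : 'Z_n) /\
  min_degree (@power_graph_Zn n) + t + 1 = m + S.
Proof.
move=> n_gt1 n_def [_ S_def t_def] m_min.
have cardZ : #|'Z_n| = n by rewrite card_ord Zp_cast.
have x_ord : #[k%:R%R : 'Z_n]%g = m.
  rewrite order_Zn_nat // {1}n_def ?dvdn_mulr // mulKn //.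
  by move: n_gt1; rewrite n_def; case: (k).
move: (k%:R%R : 'Z_n) x_ord => x x_ord.
have degE (y : 'Z_n) : degree (@power_graph_Zn n) y + totient #[y]%g + 1
    = #[y]%g + mult_totient_sum n #[y]%g.
  by have := degree_power_graph_cyclic y (Zn_cyclic n); rewrite cardZ.
have x_min : is_min_degree_vertex (@power_graph_Zn n) x.
  move=> y; have y_dvd : #[y]%g %| n by have := order_dvdG (in_setT y); rewrite cardsT cardZ.
  have [S' [t' [[_ S'_def t'_def]]]] := m_min _ y_dvd.
  by have := degE x; have := degE y; rewrite x_ord; lia.
by rewrite (is_min_degree_vertex_min_degree x_min) -S_def -t_def -x_ord degE.
Qed.

Lemma prime_coprime_lt p q : prime p -> prime q -> p < q -> coprime p q.
Proof. by move=> p_pr q_pr pq; rewrite prime_coprime // dvdn_prime2 // ltn_eqF. Qed.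

Lemma totient_data_squarefree3 p q r (b1 b2 b3 : bool) :
  prime p -> prime q -> prime r -> p < q -> q < r ->
  totient_data (p * q * r) (p ^ b1 * q ^ b2 * r ^ b3)
    ((p - b1) * (q - b2) * (r - b3)) (p.-1 ^ b1 * q.-1 ^ b2 * r.-1 ^ b3).
Proof.
move=> p_pr q_pr r_pr pq qr.
apply: totient_dataM; rewrite ?muln_gt0 ?prime_gt0 ?coprimeMl ?prime_coprime_lt ?(ltn_trans pq) //;
  last exact: totient_data_prime.
by apply: totient_dataM; rewrite ?prime_gt0 ?prime_coprime_lt //; apply: totient_data_prime.
Qed.

Lemma totient_data_squarefree4 p q r s (b1 b2 b3 b4 : bool) :
  prime p -> prime q -> prime r -> prime s -> p < q -> q < r -> r < s ->
  totient_data (p * q * r * s) (p ^ b1 * q ^ b2 * r ^ b3 * s ^ b4)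
    ((p - b1) * (q - b2) * (r - b3) * (s - b4))
    (p.-1 ^ b1 * q.-1 ^ b2 * r.-1 ^ b3 * s.-1 ^ b4).
Proof.
move=> p_pr q_pr r_pr s_pr pq qr rs; have qs := ltn_trans qr rs; have ps := ltn_trans pq qs.
apply: totient_dataM; rewrite ?muln_gt0 ?prime_gt0 ?coprimeMl ?prime_coprime_lt //.
  exact: totient_data_squarefree3.
exact: totient_data_prime.
Qed.

Lemma dvdn_squarefree3 p q r m : prime p -> prime q -> prime r -> m %| p * q * r ->
  exists b1 b2 b3 : bool, m = p ^ b1 * q ^ b2 * r ^ b3.
Proof.
move=> p_pr q_pr r_pr; have pq_gt0 : 0 < p * q by rewrite muln_gt0 !prime_gt0.
case/(dvdn_mul_split pq_gt0) => xy [z [-> xy_dvd /(dvdn_primeP r_pr)[b3 ->]]].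
have [x [y [-> /(dvdn_primeP p_pr)[b1 ->] /(dvdn_primeP q_pr)[b2 ->]]]] :=
  dvdn_mul_split (prime_gt0 p_pr) xy_dvd.
by exists b1, b2, b3.
Qed.

Lemma dvdn_squarefree4 p q r s m : prime p -> prime q -> prime r -> prime s ->
  m %| p * q * r * s -> exists b1 b2 b3 b4 : bool, m = p ^ b1 * q ^ b2 * r ^ b3 * s ^ b4.
Proof.
move=> p_pr q_pr r_pr s_pr; have pqr_gt0 : 0 < p * q * r by rewrite !muln_gt0 !prime_gt0.
case/(dvdn_mul_split pqr_gt0) => x [y [-> x_dvd /(dvdn_primeP s_pr)[b4 ->]]].
have [b1 [b2 [b3 ->]]] := dvdn_squarefree3 p_pr q_pr r_pr x_dvd.
by exists b1, b2, b3, b4.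
Qed.

(** The denominator is positive and is cleared; the truncated subtractions are exact because
    [r < s]. *)
Lemma rat_conditionE q r s : 1 < q -> 0 < r -> r < s ->
  ((r%:R + 2%:R * (r%:R - 1) / (q%:R - 1) <= s%:R :> rat) = (2 * r.-1 <= (s - r) * q.-1)%N)%R.
Proof.
move=> q_gt1 r_gt0 rs; have q1_gt0 : (0 < q%:R - 1 :> rat)%R by rewrite subr_gt0 ltr1n.
have predE k : 0 < k -> (k%:R - 1 = k.-1%:R :> rat)%R by move=> k_gt0; rewrite -subn1 natrB.
rewrite addrC -lerBrDr ler_pdivrMr // !predE ?(ltnW q_gt1) // -natrB ?(ltnW rs) //.
by rewrite -!natrM ler_nat.
Qed.

(** * Minimum degrees for each factorization type of [n] *)

Lemma min_degree_two_pfactors p q a b : prime p -> prime q -> p < q -> 0 < a -> 0 < b ->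
  let n := p ^ a * q ^ b in
  is_min_degree_vertex (@power_graph_Zn n) ((q ^ b)%:R%R : 'Z_n) /\
  min_degree (@power_graph_Zn n) = (q ^ b - 1) * totient (p ^ a) + p ^ a - 1.
Proof.
move=> p_pr q_pr pq; case: a b => [//|a] [//|b] _ _ n.
have p_gt1 := prime_gt1 p_pr; have q_gt1 := prime_gt1 q_pr.
have P_gt1 : 1 < p ^ a.+1 by rewrite (ltn_exp2l 0).
have Q_gt1 : 1 < q ^ b.+1 by rewrite (ltn_exp2l 0).
have co : coprime (p ^ a.+1) (q ^ b.+1).
  by rewrite coprimeXl ?coprimeXr ?prime_coprime_lt.
have P_gt0 := ltnW P_gt1; have Q_gt0 := ltnW Q_gt1.
(* The candidate order is [p ^ a.+1], whose component at [q] is 1. *)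
have dQ : totient_data (q ^ b.+1) 1 (q ^ b.+1) 1.
  by split; rewrite ?mult_totient_sum1 ?dvd1n.
have dn := totient_dataM P_gt0 Q_gt0 co (totient_data_pfactor a p_pr) dQ.
rewrite !muln1 in dn.
have [|||x_min deg_eq] := min_degree_power_graph_Zn (k := q ^ b.+1) _ _ dn.
- by rewrite (leq_trans P_gt1) // leq_pmulr.
- exact: mulnC.
- move=> m m_dvd; have [m1 [m2 [-> m1_dvd m2_dvd]]] := dvdn_mul_split P_gt0 m_dvd.
  have [S1 [t1 [c1 d1]]] := dvdn_pfactor_data p_pr m1_dvd.
  have [S2 [t2 [c2 d2]]] := dvdn_pfactor_data q_pr m2_dvd.
  exists (S1 * S2), (t1 * t2); split; first exact: totient_dataM.
  rewrite [p ^ a.+1]expnS [q ^ b.+1]expnS.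
  by apply: (pfactor_bound p_gt1 pq _ _ c1 c2); rewrite expn_gt0 prime_gt0.
split=> //; move: (min_degree _) deg_eq => D; rewrite totient_pfactor //=.
by case: (q ^ b.+1) Q_gt0 => // Q _; rewrite mulnS subSS subn0 [Q * _]mulnC; lia.
Qed.

Lemma min_degree_three_primes p q r : prime p -> prime q -> prime r -> p < q -> q < r ->
  let n := p * q * r in
  is_min_degree_vertex (@power_graph_Zn n) (r%:R%R : 'Z_n) /\
  min_degree (@power_graph_Zn n) = totient n + p * q - 1.
Proof.
move=> p_pr q_pr r_pr pq qr n.
have p_gt1 := prime_gt1 p_pr; have r_gt1 := prime_gt1 r_pr.
have dn b1 b2 b3 := totient_data_squarefree3 b1 b2 b3 p_pr q_pr r_pr pq qr.
have [|||x_min deg_eq] := min_degree_power_graph_Zn (k := r) _ _ (dn true true false).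
- by rewrite (leq_trans r_gt1) // leq_pmull // muln_gt0 !prime_gt0.
- by rewrite expn0 !expn1 muln1 mulnC.
- move=> m /(dvdn_squarefree3 p_pr q_pr r_pr)[b1 [b2 [b3 ->]]].
  do 2!eexists; split; first exact: dn.
  by rewrite !expn0 !expn1 subn0 !subn1 !muln1; apply: squarefree3_bound.
(* Taking all exponents 1 gives the totient of [n], which is the totient sum minus the totient at
   order [p * q]. *)
split=> //; have [_ _] := dn true true true; move: deg_eq.
rewrite !expn0 !expn1 subn0 !subn1 !muln1 -/n => deg_eq ->.
by move: (min_degree _) deg_eq => D; case: (r) r_gt1 => // r' _; rewrite mulnS /=; lia.
Qed.

(** Some factor is 2, and the primes above [p] exceed 2. *)
Lemma even_prime_product4 p q r s : prime p -> prime q -> prime r -> prime s ->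
  p < q -> q < r -> r < s -> ~~ odd (p * q * r * s) -> p = 2.
Proof.
move=> p_pr q_pr r_pr s_pr pq qr rs; have p_gt1 := prime_gt1 p_pr.
rewrite !oddM; case: (even_prime p_pr) => // ->.
case: (even_prime q_pr) => [|->]; first lia.
case: (even_prime r_pr) => [|->]; first lia.
by case: (even_prime s_pr) => [|->]; first lia.
Qed.

Lemma min_degree_four_primes_far p q r s :
  prime p -> prime q -> prime r -> prime s -> p < q -> q < r -> r < s ->
  let n := p * q * r * s in
  odd n \/ 2 * r.-1 <= (s - r) * q.-1 ->
  is_min_degree_vertex (@power_graph_Zn n) (s%:R%R : 'Z_n) /\
  min_degree (@power_graph_Zn n) = totient n + p * q * r - 1.
Proof.
move=> p_pr q_pr r_pr s_pr pq qr rs n cond.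
have p_gt1 := prime_gt1 p_pr; have s_gt1 := prime_gt1 s_pr.
have dn b1 b2 b3 b4 :=
  totient_data_squarefree4 b1 b2 b3 b4 p_pr q_pr r_pr s_pr pq qr rs.
have [|||x_min deg_eq] := min_degree_power_graph_Zn (k := s) _ _ (dn true true true false).
- by rewrite (leq_trans s_gt1) // leq_pmull // !muln_gt0 !prime_gt0.
- by rewrite expn0 !expn1 muln1 mulnC.
- move=> m /(dvdn_squarefree4 p_pr q_pr r_pr s_pr)[b1 [b2 [b3 [b4 ->]]]].
  do 2!eexists; split; first exact: dn.
  rewrite !expn0 !expn1 subn0 !subn1 !muln1.
  case: (boolP (odd n)) cond => [n_odd _ | n_even [//|bound]].
    move: n_odd; rewrite !oddM => /andP[/andP[/andP[p_odd q_odd] r_odd] s_odd].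
    (* Parity yields [2 < p] and the gaps of at least 2. *)
    by apply: squarefree4_odd_bound; lia.
  have p2 := even_prime_product4 p_pr q_pr r_pr s_pr pq qr rs n_even.
  by move: pq; rewrite p2 => q_gt2; apply: squarefree4_even_far_bound.
split=> //; have [_ _] := dn true true true true; move: deg_eq.
rewrite !expn0 !expn1 subn0 !subn1 !muln1 -/n => deg_eq ->.
by move: (min_degree _) deg_eq => D; case: (s) s_gt1 => // s' _; rewrite mulnS /=; lia.
Qed.

Lemma min_degree_four_primes_close p q r s :
  prime p -> prime q -> prime r -> prime s -> p < q -> q < r -> r < s ->
  let n := p * q * r * s in
  ~~ odd n -> (s - r) * q.-1 < 2 * r.-1 ->
  is_min_degree_vertex (@power_graph_Zn n) ((r * s)%:R%R : 'Z_n) /\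
  min_degree (@power_graph_Zn n) = (q - 1) * (r * s + 1) + 1.
Proof.
move=> p_pr q_pr r_pr s_pr pq qr rs n n_even bound.
have p2 := even_prime_product4 p_pr q_pr r_pr s_pr pq qr rs n_even.
have s_gt1 := prime_gt1 s_pr; have q_gt1 := prime_gt1 q_pr; have r_gt0 := prime_gt0 r_pr.
have dn b1 b2 b3 b4 :=
  totient_data_squarefree4 b1 b2 b3 b4 p_pr q_pr r_pr s_pr pq qr rs.
have [|||x_min deg_eq] :=
  min_degree_power_graph_Zn (k := r * s) _ _ (dn true true false false).
- by rewrite (leq_trans s_gt1) // leq_pmull // !muln_gt0 !prime_gt0.
- by rewrite !expn0 !expn1 !muln1 [RHS]mulnC mulnA.
- move=> m /(dvdn_squarefree4 p_pr q_pr r_pr s_pr)[b1 [b2 [b3 [b4 ->]]]].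
  do 2!eexists; split; first exact: dn.
  rewrite !expn0 !expn1 !subn0 !subn1 !muln1.
  by move: pq; rewrite p2 => q_gt2; apply: squarefree4_even_close_bound.
have rs_gt0 : 0 < r * s by rewrite muln_gt0 r_gt0 ltnW.
split=> //; move: (min_degree _) deg_eq => D.
(* For [p = 2] the degree is [2 * q + (q - 1) * (r * s) - (q - 1) - 1], that is
   [(q - 1) * (r * s) + q]. *)
rewrite !expn0 !expn1 !subn0 !subn1 !muln1 p2 /= !mul1n -mulnA.
case: (r * s) rs_gt0 => // k _; case: (q) q_gt1 => // q' _.
by rewrite /= !mulnDr !mulnS; lia.
Qed.

Local Open Scope ring_scope.

Theorem theorem4p6 (n p1 p2 p3 p4 : nat) (hn : (0 < n)%N)
    (hp1 : prime p1) (hp2 : prime p2) (hp3 : prime p3) (hp4 : prime p4)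
    (h12 : (p1 < p2)%N) (h23 : (p2 < p3)%N) (h34 : (p3 < p4)%N) :
  (forall a1 a2 : nat, (0 < a1)%N -> (0 < a2)%N ->
     n = (p1 ^ a1 * p2 ^ a2)%N ->
     is_min_degree_vertex (@power_graph_Zn n) ((p2 ^ a2)%N%:R : 'Z_n) /\
     min_degree (@power_graph_Zn n)
       = ((p2 ^ a2 - 1) * totient (p1 ^ a1) + p1 ^ a1 - 1)%N) /\
  (n = (p1 * p2 * p3)%N ->
     is_min_degree_vertex (@power_graph_Zn n) (p3%:R : 'Z_n) /\
     min_degree (@power_graph_Zn n) = (totient n + p1 * p2 - 1)%N) /\
  (n = (p1 * p2 * p3 * p4)%N ->
     ((odd n \/
       (p4%:R : rat) >= p3%:R + 2%:R * (p3%:R - 1) / (p2%:R - 1)) ->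
      is_min_degree_vertex (@power_graph_Zn n) (p4%:R : 'Z_n) /\
      min_degree (@power_graph_Zn n) = (totient n + p1 * p2 * p3 - 1)%N) /\
     (~ (odd n \/
         (p4%:R : rat) >= p3%:R + 2%:R * (p3%:R - 1) / (p2%:R - 1)) ->
      is_min_degree_vertex (@power_graph_Zn n) ((p3 * p4)%N%:R : 'Z_n) /\
      min_degree (@power_graph_Zn n) = ((p2 - 1) * (p3 * p4 + 1) + 1)%N)).
Proof.
split=> [a1 a2 a1_gt0 a2_gt0 ->|]; first exact: min_degree_two_pfactors.
split=> [->|n_def]; first exact: min_degree_three_primes.
have q_gt1 := prime_gt1 hp2; have r_gt0 := prime_gt0 hp3.
rewrite rat_conditionE // n_def; split=> cond.
  exact: min_degree_four_primes_far.
by apply: min_degree_four_primes_close => //;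
  [apply/negP | rewrite ltnNge; apply/negP] => ?; apply: cond; [left | right].
Qed.
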